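(* Let $G$ be a $(d,k)$-digraph with repeat permutation $r$, let $\alpha>1$ be an integer, and let $H_\alpha$ be the subdigraph of $G$ induced by the set of vertices $v$ for which there exists an integer $t\geq 0$ with $\mathrm{ord}_r(v)\mid 2^t\alpha$. If $H_\alpha$ is different from $C_k$, then $H_\alpha$ is a $(d',k)$-digraph for some $d'\leq d$.
   Context: A $(d,k)$-digraph (almost Moore digraph) is a finite digraph, diregular of degree $d>1$ (every vertex has in- and out-degree $d$), of diameter $k>1$ and order $N=d+d^2+\cdots+d^k$. Every vertex $v$ has a unique vertex $r(v)$ (its repeat) such that there are exactly two walks of length $\leq k$ from $v$ to $r(v)$, at least one of them of length $k$; the map $r:V(G)\to V(G)$ is a permutation and an automorphism of $G$. A vertex with $r(v)=v$ is a self-repeat. $\mathrm{ord}_r(v)$ denotes the least $t\geq 1$ with $r^t(v)=v$. $C_k$ denotes the subdigraph of $G$ induced by the self-repeats of $G$ (for $k\geq 3$, when $G$ has self-repeats, these are exactly $k$ vertices forming a directed cycle of length $k$). *)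

(* Defs.v *)
From HB Require Import structures.
From mathcomp Require Export all_boot.
From mathcomp Require Export boolp.

Set Implicit Arguments.
Unset Strict Implicit.
Unset Printing Implicit Defensive.

(* Loops are not excluded here; they cannot occur in a (d,k)-digraph, since a
   loop at v yields at least three walks of length <= 2 from v to v. *)
Record digraph := Digraph { vertex :> finType; arc : rel vertex }.
Arguments arc : clear implicits.

(* A walk is given by its start and the sequence of its subsequent vertices, so
   that a walk of length n is an n-tuple. *)
Definition walks (G : digraph) (n : nat) (u v : G) : {set n.-tuple G} :=
  [set p : n.-tuple G | path (arc G) u p && (last u p == v)].

Definition nwalks_upto (G : digraph) (k : nat) (u v : G) : nat :=
  \sum_(n < k.+1) #|walks n u v|.

Definition is_distance (G : digraph) (u v : G) (n : nat) : Prop :=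
  (0 < #|walks n u v|) /\ (forall m, m < n -> #|walks m u v| = 0).

Definition has_diameter (G : digraph) (k : nat) : Prop :=
  (forall u v : G, exists2 n, n <= k & is_distance u v n) /\
  (exists u v : G, is_distance u v k).

Definition diregular (G : digraph) (d : nat) : Prop :=
  forall v : G, #|[set w | arc G v w]| = d /\ #|[set w | arc G w v]| = d.

Definition almost_moore (G : digraph) (d k : nat) : Prop :=
  [/\ 1 < d, 1 < k, diregular G d, has_diameter G k
    & #|G| = \sum_(1 <= i < k.+1) d ^ i].

Definition is_repeat (G : digraph) (k : nat) (v w : G) : Prop :=
  nwalks_upto k v w = 2 /\ 0 < #|walks k v w|.

Definition is_ord (T : Type) (r : T -> T) (v : T) (n : nat) : Prop :=
  [/\ 0 < n, iter n r v = v & forall m, 0 < m -> iter m r v = v -> n <= m].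

Record subdigraph (G : digraph) := Subdigraph {
  sub_verts : {set G};
  sub_arcs : {set G * G};
  _ : sub_arcs \subset [set p : G * G | arc G p.1 p.2
                          & (p.1 \in sub_verts) && (p.2 \in sub_verts)]
}.

Definition digraph_of_sub (G : digraph) (H : subdigraph G) : digraph :=
  @Digraph {x : G | x \in sub_verts H}
    (fun x y => (val x, val y) \in sub_arcs H).
Coercion digraph_of_sub : subdigraph >-> digraph.

Definition induced (G : digraph) (S : {set G}) : subdigraph G :=
  @Subdigraph G S
    [set p : G * G | arc G p.1 p.2 & (p.1 \in S) && (p.2 \in S)] (subxx _).

Definition self_repeat_sub (G : digraph) (r : G -> G) : subdigraph G :=
  induced [set v : G | r v == v].

(* boolp turns the unbounded existential over t into a boolean predicate. *)
Definition H_sub (G : digraph) (r : G -> G) (alpha : nat) : subdigraph G :=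
  induced [set v : G |
    `[< exists t n : nat, is_ord r v n /\ n %| 2 ^ t * alpha >]].

(* Main.v *)
From mathcomp Require Import all_boot zify.
Require Import Defs.

Set Implicit Arguments.
Unset Strict Implicit.
Unset Printing Implicit Defensive.

(** Write [A] for the adjacency matrix and [R] for the matrix of [r]; the
    hypotheses on [G] amount to [I + A + ... + A^k = J + R].  As [A] commutes
    with the left-hand side and, by diregularity, with [J], it commutes with
    [R], so [r] is an automorphism.

    For [u], [v] in [H_alpha] some power [phi] of [r] with exponent
    [2^t * alpha] fixes both, hence acts on the set of walks of a given length
    [<= k] from [u] to [v].  This set has at most two elements, so [phi^2] fixes
    each such walk, and its vertices lie in [H_alpha]: this is why the orders
    are only prescribed up to a power of two.  So the identity
    [I + A + ... + A^k = J + R] restricts to [H_alpha].  There [A] commutes with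
    [R], hence with [J], which says that all out-degrees and in-degrees are
    equal to one number [d'].  The cases [d' = 0] and [d' = 1] are excluded
    because in them all vertices are self-repeats. *)

(** * Counting walks *)

Lemma sum_nat_eq (T : finType) (P : pred T) (x : T) :
  \sum_(y | P y) (y == x) = P x.
Proof.
rewrite big_mkcond (bigD1 x) //= eqxx big1 ?addn0; first by case: (P x).
by move=> y /negbTE ->; case: (P y).
Qed.

Lemma card_walks0 (G : digraph) (u v : G) : #|walks 0 u v| = (u == v).
Proof.
have -> : walks 0 u v = if u == v then [set: 0.-tuple G] else set0.
  by apply/setP=> p; rewrite (tuple0 p) inE /=; case: eqP; rewrite !inE.
by case: eqP; rewrite ?cards0 // cardsT card_tuple.
Qed.

Lemma card_walksS (G : digraph) n (u v : G) :
  #|walks n.+1 u v| = \sum_(w | arc G u w) #|walks n w v|.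
Proof.
rewrite -sum1_card.
rewrite (partition_big (fun p : n.+1.-tuple G => thead p) (arc G u)) /=;
    last first.
  by move=> p; case/tupleP: p => x p; rewrite inE theadE /= => /andP[/andP[]].
apply: eq_bigr => w uw; rewrite sum1_card.
have consI : injective (fun q : n.-tuple G => [tuple of w :: q]).
  by move=> p q [] /val_inj.
rewrite -(card_imset (walks n w v) consI).
apply: eq_card => p; case/tupleP: p => x p; rewrite unfold_in inE theadE /=.
apply/idP/imsetP => [/andP[/andP[/andP[_ pw] lp] /eqP xw]|[q]].
  subst x; exists p; last exact: val_inj.
  by rewrite inE pw.
rewrite inE => /andP[pq lq] [-> ->].
by rewrite uw pq lq eqxx.
Qed.

(** A tuple exposes the first arc of a walk, not the last, so this follows from [card_walksS] by
    induction and an exchange of sums. *)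
Lemma card_walksSr (G : digraph) n (u v : G) :
  #|walks n.+1 u v| = \sum_(w | arc G w v) #|walks n u w|.
Proof.
elim: n u v => [|n IH] u v.
  rewrite card_walksS.
  under eq_bigr => w _ do rewrite card_walks0.
  under [RHS]eq_bigr => w _ do rewrite card_walks0 eq_sym.
  by rewrite !sum_nat_eq.
rewrite card_walksS; under eq_bigr => w _ do rewrite IH.
rewrite exchange_big; apply: eq_bigr => w _.
by rewrite card_walksS.
Qed.

Lemma sum_walks_from (G : digraph) d n (u : G) :
  (forall v : G, #|[set w | arc G v w]| = d) -> \sum_v #|walks n u v| = d ^ n.
Proof.
move=> outd; elim: n u => [|n IH] u.
  under eq_bigr => v _ do rewrite card_walks0 eq_sym.
  by rewrite sum_nat_eq.
under eq_bigr => v _ do rewrite card_walksS.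
rewrite exchange_big /=; under eq_bigr => w _ do rewrite IH.
by rewrite sum_nat_const -(outd u) cardsE expnS.
Qed.

Lemma sum_walks_to (G : digraph) d n (v : G) :
  (forall u : G, #|[set w | arc G w u]| = d) -> \sum_u #|walks n u v| = d ^ n.
Proof.
move=> ind; elim: n v => [|n IH] v.
  under eq_bigr => u _ do rewrite card_walks0.
  by rewrite sum_nat_eq.
under eq_bigr => u _ do rewrite card_walksSr.
rewrite exchange_big /=; under eq_bigr => w _ do rewrite IH.
by rewrite sum_nat_const -(ind v) cardsE expnS.
Qed.

Lemma sum_expn_split d k :
  \sum_(n < k.+1) d ^ n = 1 + \sum_(1 <= i < k.+1) d ^ i.
Proof.
by rewrite -(big_mkord xpredT (fun n => d ^ n)) big_nat_recl // expn0 big_add1.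
Qed.

Lemma sum_nwalks_from (G : digraph) d k (u : G) :
  (forall v : G, #|[set w | arc G v w]| = d) ->
  \sum_v nwalks_upto k u v = 1 + \sum_(1 <= i < k.+1) d ^ i.
Proof.
move=> outd; rewrite /nwalks_upto exchange_big /= -sum_expn_split.
by apply: eq_bigr => n _; exact: sum_walks_from.
Qed.

Lemma sum_nwalks_to (G : digraph) d k (v : G) :
  (forall u : G, #|[set w | arc G w u]| = d) ->
  \sum_u nwalks_upto k u v = 1 + \sum_(1 <= i < k.+1) d ^ i.
Proof.
move=> ind; rewrite /nwalks_upto exchange_big /= -sum_expn_split.
by apply: eq_bigr => n _; exact: sum_walks_to.
Qed.

(** Both sides count the walks from [u] to [v] of lengths 1 to [k.+1], split at the first or at the
    last arc. *)
Lemma nwalks_upto_comm (G : digraph) k (u v : G) :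
  \sum_(w | arc G u w) nwalks_upto k w v
  = \sum_(w | arc G w v) nwalks_upto k u w.
Proof.
rewrite /nwalks_upto exchange_big [RHS]exchange_big /=.
by apply: eq_bigr => n _; rewrite -card_walksS -card_walksSr.
Qed.

Lemma leq_card_walks_upto (G : digraph) k n (u v : G) :
  n <= k -> #|walks n u v| <= nwalks_upto k u v.
Proof.
move=> nk; have nk1 : n < k.+1 by [].
by rewrite /nwalks_upto (bigD1 (Ordinal nk1)) //= leq_addr.
Qed.

Lemma distance_of_nwalks (G : digraph) k (u v : G) :
  0 < nwalks_upto k u v -> exists2 n, n <= k & is_distance u v n.
Proof.
rewrite lt0n sum_nat_eq0 => /forallPn[i]; rewrite implyTb -lt0n => hi.
have ex : exists n, 0 < #|walks n u v| by exists i.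
have le_ex : ex_minn ex <= i by case: ex_minnP => m _; apply.
exists (ex_minn ex); first by apply: leq_trans le_ex _; rewrite -ltnS.
case: ex_minnP => m hm min; split=> // j jm; apply/eqP.
by rewrite -leqn0 leqNgt; apply/negP => /min; rewrite leqNgt jm.
Qed.

(** * The identity [I + A + ... + A^k = J + R] *)

Definition repeat_identity (G : digraph) (k : nat) (r : G -> G) : Prop :=
  forall u v : G, nwalks_upto k u v = 1 + (v == r u).

(** The diameter and the repeat bound each entry from below; the bounds add up to [#|G| + 1], which
    is the number of all walks of length at most [k] from [u], so every bound is attained. *)
Lemma almost_moore_repeat_identity (G : digraph) d k (r : G -> G) :
  almost_moore G d k -> (forall v : G, is_repeat k v (r v)) ->
  repeat_identity k r.
Proof.
move=> [_ _ dreg [diam _] cardG] hr u v.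
have ge1 w : 1 <= nwalks_upto k u w.
  have [n nk [hn _]] := diam u w.
  exact: leq_trans hn (leq_card_walks_upto u w nk).
have total : \sum_w nwalks_upto k u w = #|G| + 1.
  by rewrite cardG addnC; apply: sum_nwalks_from => x; case: (dreg x).
have [ru _] := hr u.
have sum1 : \sum_w (1 + (w == r u)) = #|G| + 1.
  by rewrite big_split /= sum_nat_eq sum1_card.
have ge w : 1 + (w == r u) <= nwalks_upto k u w.
  by case: eqP => [->|_]; rewrite ?ru ?ge1.
have gt0 : \sum_w (nwalks_upto k u w - (1 + (w == r u))) = 0.
  by rewrite sumnB ?total ?sum1 ?subnn // => w _; exact: ge.
move/eqP: gt0; rewrite sum_nat_eq0 => /forallP /(_ v) /=.
by move=> h; apply/eqP; rewrite eqn_leq ge andbT -subn_eq0.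
Qed.

(** Entry [(u, v)] of [A (J + R) = (J + R) A]. No regularity is assumed, so that it also applies to
    the induced subdigraph. *)
Lemma repeat_identity_degrees (G : digraph) k (r : G -> G) (u v : G) :
  repeat_identity k r ->
  #|[set w | arc G u w]| + \sum_(w | arc G u w) (v == r w)
  = #|[set w | arc G w v]| + arc G (r u) v.
Proof.
move=> Sr; have := nwalks_upto_comm k u v.
under eq_bigr => w _ do rewrite Sr.
under [X in _ = X]eq_bigr => w _ do rewrite Sr.
by rewrite !big_split /= !sum1_card !cardsE sum_nat_eq.
Qed.

(** The column of [J + R] at [r x] sums to [#|G| + 1], which leaves room for a single preimage of
    [r x]. *)
Lemma repeat_injective (G : digraph) d k (r : G -> G) :
  (forall u : G, #|[set w | arc G w u]| = d) ->
  #|G| = \sum_(1 <= i < k.+1) d ^ i ->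
  repeat_identity k r -> injective r.
Proof.
move=> ind cardG Sr x y rxy; apply/eqP; apply/negPn/negP => nxy.
have : \sum_u nwalks_upto k u (r x) = #|G| + 1.
  by rewrite (sum_nwalks_to _ _ ind) cardG addnC.
under eq_bigr => u _ do rewrite Sr.
rewrite big_split /= sum1_card => /addnI.
rewrite (bigD1 x) // eqxx (bigD1 y) /= ?rxy ?eqxx //.
by rewrite eq_sym.
Qed.

Lemma sum_repeat_eq (G : digraph) (r : G -> G) (u x : G) :
  injective r -> \sum_(w | arc G u w) (r x == r w) = arc G u x.
Proof.
move=> rI; under eq_bigr => w _ do rewrite inj_eq // eq_sym.
exact: sum_nat_eq.
Qed.

Lemma repeat_arc (G : digraph) d k (r : G -> G) :
  diregular G d -> injective r -> repeat_identity k r ->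
  forall u v, arc G (r u) (r v) = arc G u v.
Proof.
move=> dreg rI Sr u v.
have := repeat_identity_degrees u (r v) Sr.
have [-> _] := dreg u; have [_ ->] := dreg (r v) => /addnI.
by rewrite sum_repeat_eq //; case: (arc G u v) (arc G (r u) (r v)) => [] [].
Qed.

(** If [r u] differs from [u], both walks from [u] to [r u] pass through the only out-neighbour [w],
    which leaves two walks of length below [k] from [w] to [r u]. For [w] distinct from [u] the
    identity allows only one. *)
Lemma repeat_out_degree1 (G : digraph) k (r : G -> G) (u : G) :
  1 < k -> injective r -> repeat_identity k r ->
  #|[set w | arc G u w]| = 1 -> r u = u.
Proof.
move=> k1 rI Sr /eqP/cards1P[w outu].
have arcu x : arc G u x = (x == w) by have /setP/(_ x) := outu; rewrite !inE.
apply/eqP/negPn/negP => nru.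
have := Sr u (r u); rewrite eqxx /nwalks_upto big_ord_recl /= card_walks0.
rewrite eq_sym (negbTE nru) add0n.
under eq_bigr => n _ do rewrite card_walksS (eq_bigl _ _ arcu) big_pred1_eq.
have := Sr w (r u); rewrite /nwalks_upto big_ord_recr /= (inj_eq rI).
case: (eqVneq u w) => [uw _ _|_ h1 h2]; last by lia.
(* Here [u] carries a loop: the empty walk and the loop are two walks from [u] to itself, where the
   identity allows one. *)
have := Sr u u; rewrite eq_sym (negbTE nru) /nwalks_upto.
case: k k1 {Sr} => // k k1.
rewrite !big_ord_recl /= card_walks0 eqxx card_walksS (eq_bigl _ _ arcu).
by rewrite big_pred1_eq card_walks0 -uw eqxx; lia.
Qed.

Lemma repeat_identity_almost_moore (G : digraph) k (r : G -> G) (u0 : G) :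
  1 < k -> injective r -> (forall u v, arc G (r u) (r v) = arc G u v) ->
  repeat_identity k r -> r u0 <> u0 ->
  almost_moore G #|[set w | arc G u0 w]| k.
Proof.
move=> k1 rI rarc Sr nru0; set d := #|_|.
(* As [A] and [R] commute, their terms cancel and [A J = J A] remains. *)
have deg u v : #|[set w | arc G u w]| = #|[set w | arc G w v]|.
  have := repeat_identity_degrees u v Sr.
  by rewrite -(f_invF rI v) sum_repeat_eq // rarc => /addIn.
have ind v : #|[set w | arc G w v]| = d by rewrite -(deg u0).
have outd v : #|[set w | arc G v w]| = d by rewrite (deg v u0).
have cardG : #|G| = \sum_(1 <= i < k.+1) d ^ i.
  have := sum_nwalks_from k u0 outd.
  under eq_bigr => v _ do rewrite Sr.
  by rewrite big_split /= sum_nat_eq sum1_card addnC => /addnI.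
have d1 : 1 < d.
  rewrite ltn_neqAle eq_sym; apply/andP; split.
    by apply/negP => /eqP /(repeat_out_degree1 k1 rI Sr).
  rewrite lt0n; apply/negP => /eqP d0.
  have : 0 < #|G| by apply/card_gt0P; exists u0.
  rewrite cardG d0 big_nat big1 // => i /andP[i0 _].
  by rewrite exp0n.
have diam (u v : G) : exists2 n, n <= k & is_distance u v n.
  by apply: distance_of_nwalks; rewrite Sr.
split=> //; split=> //; exists u0.
apply: contrapT => nodist.
(* The diameter is now written [k.+1]. If no vertex were at that distance from [u0], walks of length
   at most [k] would reach all of [G], forcing [d ^ k.+1 <= 1]. *)
case: k k1 Sr cardG diam nodist => // k k1 Sr cardG diam nodist.
have le v : 1 <= nwalks_upto k u0 v.
  have [n nk dn] := diam u0 v.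
  have {}nk : n <= k.
    rewrite -ltnS ltn_neqAle nk andbT; apply/negP => /eqP nk1.
    by apply: nodist; exists v; rewrite -nk1.
  exact: leq_trans dn.1 (leq_card_walks_upto u0 v nk).
have : #|G| <= \sum_v nwalks_upto k u0 v.
  by rewrite -sum1_card; apply: leq_sum.
rewrite (sum_nwalks_from k u0 outd) cardG big_nat_recr //= addnC leq_add2r.
by rewrite leqNgt -[X in X < _](expn0 d) ltn_exp2l.
Qed.

(** * Induced subdigraphs *)

Lemma arc_induced (G : digraph) (S : {set G}) (x y : induced S) :
  arc (induced S) x y = arc G (val x) (val y).
Proof.
rewrite /= inE /=; case: x y => x xS [y yS] /=.
by move: xS yS => /= -> ->; rewrite !andbT.
Qed.

Lemma card_walks_induced (G : digraph) (S : {set G}) n (u v : induced S) :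
  (forall p, p \in walks n (val u) (val v) -> {subset p <= S}) ->
  #|walks n u v| = #|walks n (val u) (val v)|.
Proof.
move=> walkS.
pose f (p : n.-tuple (induced S)) : n.-tuple G := map_tuple val p.
have fI : injective f.
  by move=> p q /(congr1 val) /(inj_map val_inj) /val_inj.
have fP p : (f p \in walks n (val u) (val v)) = (p \in walks n u v).
  rewrite !inE /= path_map last_map (inj_eq val_inj); congr (_ && _).
  by apply: eq_path => x y; symmetry; exact: arc_induced.
rewrite -(card_imset _ fI); apply: eq_card => p.
apply/imsetP/idP => [[q qw ->]|pw]; first by rewrite fP.
(* The default [u] of [insubd] never occurs, since [p] stays in [S]. *)
have fq : f (map_tuple (insubd u) p) = p.
  apply: val_inj; rewrite /= -map_comp; apply: map_id_in => x xp.
  by rewrite /= insubdK //; exact: walkS pw x xp.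
by exists (map_tuple (insubd u) p); rewrite // -fP fq.
Qed.

(** * Vertices fixed by a power of the repeat permutation *)

Lemma iter_arc (G : digraph) (r : G -> G) m :
  (forall u v, arc G (r u) (r v) = arc G u v) ->
  forall u v, arc G (iter m r u) (iter m r v) = arc G u v.
Proof. by move=> rarc u v; elim: m => //= m <-; rewrite rarc. Qed.

Lemma iter_injective (T : Type) (r : T -> T) m :
  injective r -> injective (iter m r).
Proof. by move=> rI x y; elim: m => //= m IH /rI. Qed.

Lemma iter_fixed_mul (T : Type) (r : T -> T) a b x :
  iter a r x = x -> iter (b * a) r x = x.
Proof. by move=> fx; elim: b => //= b IH; rewrite mulSn iterD IH. Qed.

Lemma fixed_walks (G : digraph) k (r : G -> G) m n (u v : G) :
  injective r -> (forall u v, arc G (r u) (r v) = arc G u v) ->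
  repeat_identity k r -> n <= k ->
  iter m r u = u -> iter m r v = v ->
  forall p, p \in walks n u v -> {in p, forall x, iter (2 * m) r x = x}.
Proof.
move=> rI rarc Sr nk fu fv p pw.
pose f (q : n.-tuple G) : n.-tuple G := map_tuple (iter m r) q.
have fI : injective f.
  move=> q1 q2 /(congr1 val) /= /inj_map eq_q.
  by apply/val_inj/eq_q; exact: iter_injective.
have fw q : q \in walks n u v -> f q \in walks n u v.
  rewrite !inE /= => /andP[pq /eqP lq].
  rewrite -fu path_map last_map lq fv eqxx andbT.
  by rewrite (eq_path (e' := arc G)) // => x y /=; rewrite iter_arc.
(* Otherwise [p], [f p] and [f (f p)] would be three distinct walks, while the identity allows at
   most two. *)
have /eqP/(congr1 val) /= : f (f p) == p.
  apply/negPn/negP => nff.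
  have nf : f p != p by apply: contra nff => /eqP e; rewrite !e.
  have le2 : #|walks n u v| <= 2.
    by apply: leq_trans (leq_card_walks_upto u v nk) _; rewrite Sr; case: eqP.
  suff : 3 <= #|walks n u v| by rewrite leqNgt ltnS le2.
  rewrite cardE; apply: (@uniq_leq_size _ [:: p; f p; f (f p)]).
    by rewrite /= !inE negb_or !(eq_sym p) (eq_sym (f p)) (inj_eq fI) nf nff.
  move=> q; rewrite mem_enum !in_cons orbF.
  by case/or3P=> /eqP ->; [|exact: fw|exact/fw/fw].
rewrite -map_comp -[RHS]map_id => /eq_in_map ffp x xp.
by rewrite mul2n -addnn iterD; exact: ffp.
Qed.

Lemma is_ord_dvd (T : Type) (r : T -> T) (v : T) n m :
  is_ord r v n -> iter m r v = v -> n %| m.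
Proof.
move=> [n0 fn min] fm; rewrite /dvdn eqn0Ngt; apply/negP => mod0.
have fmod : iter (m %% n) r v = v.
  by move: fm; rewrite {1}(divn_eq m n) addnC iterD iter_fixed_mul.
by have := min _ mod0 fmod; rewrite leqNgt ltn_mod n0.
Qed.

Lemma ex_is_ord (T : eqType) (r : T -> T) (v : T) m :
  0 < m -> iter m r v = v -> exists n, is_ord r v n.
Proof.
move=> m0 fm.
have ex : exists n, (0 < n) && (iter n r v == v).
  by exists m; rewrite m0 fm eqxx.
exists (ex_minn ex); case: ex_minnP => n /andP[n0 /eqP fn] min.
split=> // j j0 fj.
by apply: min; rewrite j0 fj eqxx.
Qed.

(** Trades orders for fixed points of iterates, so that membership becomes arithmetic of
    exponents. *)
Lemma mem_H_sub (G : digraph) (r : G -> G) alpha (v : G) :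
  0 < alpha ->
  v \in sub_verts (H_sub r alpha) <-> exists t, iter (2 ^ t * alpha) r v = v.
Proof.
move=> a0; rewrite inE; split=> [|[t ft]].
  move=> /asboolP[t [n [[_ fn _] /dvdnP[q mE]]]].
  by exists t; rewrite mE; exact: iter_fixed_mul.
apply/asboolP; exists t.
have m0 : 0 < 2 ^ t * alpha by rewrite muln_gt0 expn_gt0.
have [n on] := ex_is_ord m0 ft.
by exists n; split=> //; exact: is_ord_dvd ft.
Qed.

Theorem theorem1 (G : digraph) (d k : nat) (hG : almost_moore G d k)
    (r : G -> G) (hr : forall v : G, is_repeat k v (r v))
    (alpha : nat) (halpha : 1 < alpha)
    (hH : H_sub r alpha <> self_repeat_sub r) :
  exists d' : nat, d' <= d /\ almost_moore (H_sub r alpha) d' k.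
Proof.
have Sr := almost_moore_repeat_identity hG hr.
have [_ k1 dreg _ cardG] := hG.
have rI : injective r.
  by apply: repeat_injective cardG Sr => u; case: (dreg u).
have rarc := repeat_arc dreg rI Sr.
have a0 := ltnW halpha.
set S : {set G} := sub_verts (H_sub r alpha).
have SE v : v \in S <-> exists t, iter (2 ^ t * alpha) r v = v.
  exact: mem_H_sub.
change (H_sub r alpha) with (induced S) in hH |- *.
(* Self-repeats always lie in [S], so without such a [u0] the two subdigraphs would coincide. *)
have [u0 u0S nru0] : exists2 u0, u0 \in S & r u0 <> u0.
  apply: contrapT => none; apply: hH; congr induced; apply/setP => v.
  rewrite inE; apply/idP/eqP => [vS|rv].
    by apply: contrapT => nrv; apply: none; exists v.
  by apply/SE; exists 0; rewrite -[_ * alpha]muln1; exact: iter_fixed_mul.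
have rS v : v \in S -> r v \in S.
  by move=> /SE[t ft]; apply/SE; exists t; rewrite -iterSr iterS ft.
pose rH (v : induced S) : induced S := Sub (r (val v)) (rS _ (valP v)).
have walkS n (u v : induced S) : n <= k ->
    forall p, p \in walks n (val u) (val v) -> {subset p <= S}.
  move=> nk p pw x xp.
  have /SE[t1 f1] := valP u; have /SE[t2 f2] := valP v.
  (* The exponent [2 ^ (t1 + t2) * alpha] fixes both ends; the successor supplies the factor 2 of
     [fixed_walks]. *)
  apply/SE; exists (t1 + t2).+1; rewrite expnS -mulnA.
  apply: (fixed_walks rI rarc Sr nk _ _ pw xp).
    by rewrite expnD mulnAC mulnC; exact: iter_fixed_mul.
  by rewrite expnD -mulnA; exact: iter_fixed_mul.
have SrH : repeat_identity k rH.
  move=> u v; rewrite -(inj_eq val_inj) /= -Sr /nwalks_upto.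
  apply: eq_bigr => n _; apply: card_walks_induced.
  by apply: walkS; rewrite -ltnS.
exists #|[set w | arc (induced S) (Sub u0 u0S) w]|; split; last first.
  apply: (repeat_identity_almost_moore (r := rH)) => //.
  - by move=> u v /(congr1 val) /= /rI /val_inj.
  - by move=> u v; rewrite !arc_induced /= rarc.
  - by move=> /(congr1 val).
(* Out-neighbours of [u0] in the subdigraph embed into those in [G], whence [d' <= d]. *)
have [<- _] := dreg u0.
rewrite -(card_imset _ (val_inj (sT := {x : G | x \in S}))).
apply/subset_leq_card/subsetP => x /imsetP[w].
by rewrite !inE arc_induced => uw ->.
Qed.
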